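(* Let $\mathbb{F}$ be a field of characteristic $2$, let $R$ be a root datum of type $\mathrm{A}_1^{\mathrm{SC}}$, $\mathrm{B}_2^{\mathrm{SC}}$, or $\mathrm{C}_n^{\mathrm{SC}}$ (where $n\ge 3$), and let $L = L_{\mathbb{F}}(R)$ be the Lie algebra of type $R$ over $\mathbb{F}$. Then there exist no regular semisimple elements in $L$.
   Context: Root datum and Chevalley Lie algebra. A root datum $R = (X,\Phi,Y,\Phi^\vee)$ of rank $n$ consists of free $\mathbb{Z}$-modules $X,Y$ of rank $n$ in duality via a pairing $\langle\cdot,\cdot\rangle: X\times Y\to\mathbb{Z}$, and finite sets of roots $\Phi\subset X$ and coroots $\Phi^\vee\subset Y$, both forming root systems, with a bijection $\alpha\mapsto\alpha^\vee$ such that $\langle\alpha,\alpha^\vee\rangle=2$. The superscript $\mathrm{SC}$ denotes the simply connected (semisimple) root datum with the given root system, i.e. $X/\mathbb{Z}\Phi$ is the full fundamental group; equivalently, $X$ is the weight lattice and $Y=\mathbb{Z}\Phi^\vee$. Define $L_{\mathbb{Z}}(R) = Y\oplus\bigoplus_{\alpha\in\Phi}\mathbb{Z}X_\alpha$ with the alternating bilinear bracket given by: - $[y,z]=0$ for $y,z\in Y$; - $[X_\alpha,y]=\langle\alpha,y\rangle X_\alpha$ for $y \in Y$, $\alpha\in\Phi$; - $[X_{-\alpha},X_\alpha]=\alpha^\vee$ for $\alpha\in\Phi$; - for $\alpha\ne\pm\beta$ in $\Phi$, $[X_\alpha,X_\beta]=N_{\alpha,\beta}X_{\alpha+\beta}$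 if $\alpha+\beta\in\Phi$ and $0$ otherwise. Here $N_{\alpha,\beta}=\pm(p_{\alpha,\beta}+1)$, where $p_{\alpha,\beta}$ is the largest integer such that $\alpha-p_{\alpha,\beta}\beta$ is a root, with signs chosen so that the Jacobi identity holds. Then $L_{\mathbb{F}}(R)=L_{\mathbb{Z}}(R)\otimes\mathbb{F}$. Toral subalgebras and regular semisimple elements. $L$ is a restricted Lie algebra with the $p$-map ($p=\operatorname{char}\mathbb{F}$) $x\mapsto x^p$ coming from the Lie algebra of the corresponding split algebraic group; it satisfies $X_\alpha^p=0$ and $(y\otimes 1)^p=y\otimes 1$ for $y\in Y$. An element $x\in L$ is semisimple if it lies in the $p$-subalgebra generated by $x^p$. A maximal toral subalgebra of $L$ is a commutative subalgebra consisting of semisimple elements that is maximal with respect to inclusion among subalgebras with these properties. An element $x\in L$ is regular semisimple if its centralizer $\mathrm{C}_L(x)$ is a maximal toral subalgebra of $L$. *)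

(* Defs.v *)
From mathcomp Require Import all_boot all_order all_algebra finmap.

Set Implicit Arguments.
Unset Strict Implicit.
Unset Printing Implicit Defensive.

Import GRing.Theory.
Local Open Scope fset_scope.
Local Open Scope ring_scope.

(* Both lattices are given by coordinates: X = Y = Z^n as groups, in duality
   through a unimodular Gram matrix; no dual bases are assumed. *)
Definition gram_pairing n (P : 'M[int]_n) (x y : 'rV[int]_n) : int :=
  (x *m P *m y^T) 0 0.

(* [rd_coroot] is only meaningful on [rd_roots]; the set of coroots is its
   image. *)
Record root_datum (n : nat) := RootDatum {
  rd_gram : 'M[int]_n;
  rd_roots : {fset 'rV[int]_n};
  rd_coroot : 'rV[int]_n -> 'rV[int]_n;
  rd_pairing := gram_pairing rd_gram;
  rd_coroots : {fset 'rV[int]_n} := rd_coroot @` rd_roots;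
  rd_perfect : rd_gram \in unitmx;
  rd_coroot_inj : {in rd_roots &, injective rd_coroot};
  rd_pairing2 : {in rd_roots, forall a, rd_pairing a (rd_coroot a) = 2};
  rd_reflect : {in rd_roots &, forall a b,
    b - rd_pairing b (rd_coroot a) *: a \in rd_roots};
  rd_coreflect : {in rd_roots, forall a, {in rd_coroots, forall c,
    c - rd_pairing a c *: rd_coroot a \in rd_coroots}};
  rd_reduced : {in rd_roots, forall a, a + a \notin rd_roots}
}.

Section RootSystemType.
Variables (n : nat) (R : root_datum n).

Definition is_base m (D : 'I_m -> 'rV[int]_n) : Prop :=
  [/\ forall i, D i \in rd_roots R,
      forall c : 'I_m -> int, \sum_i c i *: D i = 0 -> forall i, c i = 0
    & {in rd_roots R, forall a, exists c : 'I_m -> int,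
        a = \sum_i c i *: D i
        /\ ((forall i, 0 <= c i) \/ (forall i, c i <= 0))}].

Definition has_cartan_matrix m (C : 'M[int]_m) : Prop :=
  exists D : 'I_m -> 'rV[int]_n,
    is_base D
    /\ forall i j, rd_pairing R (D i) (rd_coroot R (D j)) = C i j.

(* Y = Z Phi^vee; by duality X is then the weight lattice. *)
Definition simply_connected : Prop :=
  forall y : 'rV[int]_n, exists c : rd_roots R -> int,
    y = \sum_(a : rd_roots R) c a *: rd_coroot R (val a).

Definition is_type_SC m (C : 'M[int]_m) : Prop :=
  simply_connected /\ has_cartan_matrix C.

End RootSystemType.

(* Bourbaki numbering, with (i, j) entry <alpha_i, alpha_j^vee>; the last
   simple root is the short one in type B and the long one in type C. *)
Definition cartanA m : 'M[int]_m := \matrix_(i, j)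
  if i == j then 2
  else if (i.+1 == j :> nat) || (j.+1 == i :> nat) then -1 else 0.

Definition cartanB m : 'M[int]_m := \matrix_(i, j)
  if (i.+1 == j :> nat) && (j.+1 == m :> nat) then -2 else cartanA m i j.

Definition cartanC m : 'M[int]_m := \matrix_(i, j)
  if (j.+1 == i :> nat) && (i.+1 == m :> nat) then -2 else cartanA m i j.

Section Chevalley.
Variables (n : nat) (R : root_datum n).

(* For a commutative ring K, this is
   (Y (x) K) (+) \bigoplus_(a in Phi) K X_a, i.e. L_Z(R) (x) K;
   K = int gives L_Z(R) itself. *)
Definition chevalley (K : comNzRingType) : Type :=
  ('rV[K]_n * {ffun rd_roots R -> K^o})%type.

Section Bracket.
Variable K : comNzRingType.

(* y (x) 1 *)
Definition torus_elt (y : 'rV[int]_n) : chevalley K :=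
  (map_mx intr y, 0).

Definition root_elt (a : rd_roots R) : chevalley K :=
  (0, [ffun b => (b == a)%:R]).

(* <a, y> for y in Y (x) K *)
Definition root_eval (a : rd_roots R) (y : 'rV[K]_n) : K :=
  (map_mx intr (val a *m rd_gram R) *m y^T) 0 0.

Variable N : 'rV[int]_n -> 'rV[int]_n -> int.

(* [X_a, X_b]; for a = b the last case applies since 2a is not a root. *)
Definition root_bracket (a b : rd_roots R) : chevalley K :=
  if val a == - val b then torus_elt (rd_coroot R (val b))
  else if insub (val a + val b) is Some c
       then (N (val a) (val b))%:~R *: root_elt c
       else 0.

Definition bracket (u v : chevalley K) : chevalley K :=
  \sum_(a : rd_roots R)
     (u.2 a * root_eval a v.1 - v.2 a * root_eval a u.1) *: root_elt a
  + \sum_(a : rd_roots R) \sum_(b : rd_roots R)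
     (u.2 a * v.2 b) *: root_bracket a b.

End Bracket.

Definition is_string_length (a b : 'rV[int]_n) (p : int) : Prop :=
  a - p *: b \in rd_roots R
  /\ forall q : int, a - q *: b \in rd_roots R -> q <= p.

Definition is_structure_constants (N : 'rV[int]_n -> 'rV[int]_n -> int) :
    Prop :=
  [/\ {in rd_roots R &, forall a b, a != b -> a != - b ->
        a + b \in rd_roots R ->
        exists2 p : int, is_string_length a b p
                       & N a b = p + 1 \/ N a b = - (p + 1)},
      forall x : chevalley int, bracket N x x = 0
    & forall x y z : chevalley int,
        bracket N x (bracket N y z) + bracket N y (bracket N z x)
        + bracket N z (bracket N x y) = 0].

End Chevalley.

Section Restricted.
Variables (F : fieldType) (L : vectType F) (br : L -> L -> L).

(* Jacobson's s_i(x, y): i * s_i(x, y) is the coefficient of t^(i-1) in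
   (ad (t x + y))^(p-1) (x), expanded as a sum over words in x and y. *)
Definition jacobson_s (p i : nat) (x y : L) : L :=
  (i%:R : F)^-1 *:
    \sum_(w : p.-1.-tuple bool | count_mem true w == i.-1)
      foldr (fun b : bool => br (if b then x else y)) x w.

Definition is_pmap (p : nat) (pm : L -> L) : Prop :=
  [/\ forall x y, br (pm x) y = iter p (br x) y,
      forall (c : F) x, pm (c *: x) = c ^+ p *: pm x
    & forall x y, pm (x + y) = pm x + pm y
                               + \sum_(1 <= i < p) jacobson_s p i x y].

Variable pm : L -> L.

Definition is_subalgebra (U : {vspace L}) : Prop :=
  {in U &, forall x y, br x y \in U}.

Definition is_psubalgebra (U : {vspace L}) : Prop :=
  is_subalgebra U /\ {in U, forall x, pm x \in U}.

Definition in_generated_psubalgebra (z x : L) : Prop :=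
  forall U : {vspace L}, is_psubalgebra U -> z \in U -> x \in U.

Definition semisimple (x : L) : Prop := in_generated_psubalgebra (pm x) x.

Definition is_toral (T : {vspace L}) : Prop :=
  [/\ is_subalgebra T, {in T &, forall x y, br x y = 0}
    & {in T, forall x, semisimple x}].

Definition is_maximal_toral (T : {vspace L}) : Prop :=
  is_toral T
  /\ forall T' : {vspace L}, is_toral T' -> (T <= T')%VS -> T' = T.

Definition is_centralizer (x : L) (C : {vspace L}) : Prop :=
  forall y, (y \in C) = (br x y == 0).

Definition regular_semisimple (x : L) : Prop :=
  exists2 C : {vspace L}, is_centralizer x C & is_maximal_toral C.

End Restricted.

(* These conditions determine the p-map: torus and root elements span
   L_F(R), and the value on a sum is fixed by the values on its terms. It is
   the p-map of the Lie algebra of the split group with root datum R. *)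
Definition is_chevalley_pmap n (R : root_datum n)
    (N : 'rV[int]_n -> 'rV[int]_n -> int) (F : fieldType) (p : nat)
    (pm : chevalley R F -> chevalley R F) : Prop :=
  [/\ is_pmap (bracket N (K := F)) p pm,
      forall a : rd_roots R, pm (root_elt F a) = 0
    & forall y : 'rV[int]_n, pm (torus_elt R F y) = torus_elt R F y].

(* Main.v *)
Require Import Defs.
From HB Require Import structures.
From mathcomp Require Import all_boot all_order all_algebra finmap.
From mathcomp Require Import ring zify.

(** Write a for the long simple root (any root in type A_1): its row in the
    Cartan matrix is even, and since every coroot is an integer combination of
    simple coroots, a pairs evenly with all of Y.  If a = b + c for roots b and
    c, evenness of <a, b^vee> and <a, c^vee> forces b and c to be orthogonal,
    so the c-string through b has the form b - c, b, b + c and N b c = +-2.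
    Hence in characteristic 2 the coefficient of X_a vanishes on every bracket
    and on every value of the p-map: there is a hyperplane M of L that contains
    [L, L] and L^[2], hence all semisimple elements.  If x were regular
    semisimple, then ker (ad x), being toral, would lie in M, and so would
    im (ad x); but ad x is semisimple, so L = ker (ad x) + im (ad x). *)

Set Implicit Arguments.
Unset Strict Implicit.
Unset Printing Implicit Defensive.

Import Order.TTheory GRing.Theory Num.Theory.
Local Open Scope ring_scope.

(** * Restricted Lie algebras in characteristic 2 *)

Section CharTwo.
Variables (F : fieldType) (L : vectType F) (br : L -> L -> L) (pm : L -> L).
Hypothesis charF : 2%N \in [pchar F].
Hypothesis br_linear_r : forall x, linear (br x).
Hypothesis br_linear_l : forall y, linear (br^~ y).
Hypothesis pmapL : is_pmap br 2 pm.

HB.instance Definition _ x := GRing.isLinear.Build F L L _ (br x) (br_linear_r x).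

(* A named copy of [br^~ y], to carry the linear structure. *)
Definition br_swap y x := br x y.
HB.instance Definition _ y :=
  GRing.isLinear.Build F L L _ (br_swap y) (br_linear_l y).

Lemma addv_self (x : L) : x + x = 0.
Proof. by rewrite -mulr2n -scaler_nat (pcharf0 charF) scale0r. Qed.

Lemma jacobson_s2 x y : \sum_(1 <= i < 2) jacobson_s br 2 i x y = br y x.
Proof.
(* The only word of length 1 without the letter [true] is [[false]]. *)
rewrite big_nat1 /jacobson_s invr1 scale1r (big_pred1 [tuple false]) // => w.
by case: w => -[|[] []].
Qed.

Lemma pmD x y : pm (x + y) = pm x + pm y + br y x.
Proof. by case: pmapL => _ _ ->; rewrite jacobson_s2. Qed.

Lemma br_pm x y : br (pm x) y = br x (br x y).
Proof. by case: pmapL => ->. Qed.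

Lemma pmZ (c : F) x : pm (c *: x) = c ^+ 2 *: pm x.
Proof. by case: pmapL => _ ->. Qed.

Lemma pm0 : pm 0 = 0.
Proof. by have := pmZ 0 0; rewrite scale0r expr0n scale0r. Qed.

(** Since [x + x = 0], [pmD x x] reduces to [pm 0 = br x x]. *)
Lemma brxx x : br x x = 0.
Proof. by move: (pmD x x); rewrite !addv_self pm0 add0r => <-. Qed.

Lemma brDl x y z : br (x + y) z = br x z + br y z.
Proof. exact: (raddfD (br_swap z)). Qed.

(* Comparing ad (pm (x + y)) = (ad x + ad y)^2 with [pmD] gives the Jacobi
   identity. *)
Lemma br_br x y z : br (br y x) z = br x (br y z) + br y (br x z).
Proof.
have := br_pm (x + y) z; rewrite pmD !brDl !br_pm !raddfD /= -!addrA => /addrI.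
by rewrite [RHS]addrA [RHS]addrC => /addrI.
Qed.

(** Closure under brackets is the Jacobi identity; closure under [pm] holds because ad ([pm u]) is
    the square of ad [u]. *)
Lemma centralizer_psubalgebra k : is_psubalgebra br pm (lker (linfun (br_swap k))).
Proof.
have cE u : (u \in lker (linfun (br_swap k))) = (br u k == 0).
  by rewrite memv_ker lfunE.
split=> [u v|u]; rewrite !cE.
  by move=> /eqP uk /eqP vk; rewrite br_br uk vk !raddf0 addr0.
by move=> /eqP uk; rewrite br_pm uk raddf0.
Qed.

(* The centralizer of k is a p-subalgebra, and it contains [pm x]. *)
Lemma semisimple_ker x k : semisimple br pm x -> br x (br x k) = 0 -> br x k = 0.
Proof.
move=> /(_ _ (centralizer_psubalgebra k)); rewrite !memv_ker !lfunE /= /br_swap.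
by rewrite br_pm => xP /eqP/xP/eqP.
Qed.

(** By [semisimple_ker], kernel and image of ad [x] meet in 0; rank-nullity does the rest. *)
Lemma semisimple_decomp x :
  semisimple br pm x -> (lker (linfun (br x)) + limg (linfun (br x)) = fullv)%VS.
Proof.
move=> ssx; set A := linfun (br x).
have dis : (lker A :&: limg A = 0)%VS.
  apply/eqP; rewrite -subv0; apply/subvP=> v; rewrite memv_cap memv0 memv_ker.
  case/andP=> + /memv_imgP[k _ vE]; rewrite vE !lfunE /= => /eqP xxk.
  by rewrite (semisimple_ker ssx xxk).
apply/eqP; rewrite eqEdim subvf /= dimv_disjoint_sum //.
by rewrite -(limg_ker_dim A fullv) capfv.
Qed.

Lemma no_regular_semisimple (M : {vspace L}) :
    (forall x y, br x y \in M) -> (forall x, pm x \in M) -> M != fullv ->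
  forall x, ~ regular_semisimple br pm x.
Proof.
move=> brM pmM Mproper x [C CE [[_ _ ssC] _]].
(* [M] is itself a p-subalgebra, and it contains [pm y]. *)
have ssM y : semisimple br pm y -> y \in M by apply; first split=> ? *.
have ssx : semisimple br pm x by apply: ssC; rewrite CE brxx.
case/negP: Mproper; rewrite eqEsubv subvf -(semisimple_decomp ssx) subv_add /=.
apply/andP; split; apply/subvP=> v.
  by rewrite memv_ker lfunE /= -CE => /ssC/ssM.
by case/memv_imgP=> k _ ->; rewrite lfunE /=.
Qed.

End CharTwo.

(** * Root data: pairing, reflections and the invariant form *)

Section RootDatum.
Variables (n : nat) (R : root_datum n).
Local Notation Phi := (rd_roots R).
Local Notation "a ^v" := (rd_coroot R a) (at level 2, format "a ^v").
Local Notation "<< x , y >>" := (rd_pairing R x y).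

Lemma pairingDl x1 x2 y : <<x1 + x2, y>> = <<x1, y>> + <<x2, y>>.
Proof. by rewrite /rd_pairing /gram_pairing !mulmxDl mxE. Qed.

Lemma pairingZl k x y : <<k *: x, y>> = k * <<x, y>>.
Proof. by rewrite /rd_pairing /gram_pairing -!scalemxAl mxE. Qed.

Lemma pairingNl x y : <<- x, y>> = - <<x, y>>.
Proof. by rewrite -scaleN1r pairingZl mulN1r. Qed.

Lemma pairingDr x y1 y2 : <<x, y1 + y2>> = <<x, y1>> + <<x, y2>>.
Proof. by rewrite /rd_pairing /gram_pairing linearD mulmxDr mxE. Qed.

Lemma pairingZr k x y : <<x, k *: y>> = k * <<x, y>>.
Proof. by rewrite /rd_pairing /gram_pairing linearZ -scalemxAr mxE. Qed.

Lemma pairingNr x y : <<x, - y>> = - <<x, y>>.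
Proof. by rewrite -scaleN1r pairingZr mulN1r. Qed.

Definition pairingE :=
  (pairingDl, pairingDr, pairingNl, pairingNr, pairingZl, pairingZr).

Lemma pairing_injr y1 y2 : (forall x, <<x, y1>> = <<x, y2>>) -> y1 = y2.
Proof.
move=> eqy; apply: trmx_inj; apply: (can_inj (mulKmx (rd_perfect R))).
apply/matrixP=> i j; rewrite (ord1 j).
have := eqy (delta_mx 0 i); rewrite /rd_pairing /gram_pairing -!mulmxA -!rowE.
by rewrite [LHS]mxE [RHS]mxE.
Qed.

Lemma pairing_eq0l x : (forall y, <<x, y>> = 0) -> x = 0.
Proof.
move=> x0; apply: (can_inj (mulmxK (rd_perfect R))); rewrite mul0mx.
apply/rowP=> j; have := x0 (delta_mx 0 j).
by rewrite /rd_pairing /gram_pairing trmx_delta -colE mxE => ->; rewrite mxE.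
Qed.

Definition refl a x := x - <<x, a^v>> *: a.
Definition corefl a c := c - <<a, c>> *: a^v.

Lemma pairing_refl a x c : <<refl a x, c>> = <<x, corefl a c>>.
Proof. by rewrite /refl /corefl !pairingE; ring. Qed.

Lemma coreflK a : a \in Phi -> involutive (corefl a).
Proof.
move=> aR c; rewrite /corefl !pairingE (rd_pairing2 aR).
rewrite -addrA -opprD -scalerDl.
by rewrite mulr_natr mulr2n addrA subrr scale0r subr0.
Qed.

Lemma coroot_mem a : a \in Phi -> a^v \in rd_coroots R.
Proof. exact: in_imfset. Qed.

Lemma corefl_perm a :
  a \in Phi -> perm_eq (map (corefl a) (rd_coroots R)) (rd_coroots R).
Proof.
move=> aR; have injc := can_inj (coreflK aR).
have sub : {subset map (corefl a) (rd_coroots R) <= rd_coroots R}.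
  by move=> _ /mapP[c cR ->]; apply: rd_coreflect.
have un : uniq (map (corefl a) (rd_coroots R)).
  by rewrite (map_inj_uniq injc) fset_uniq.
apply: uniq_perm; rewrite ?fset_uniq //.
by have [|_ //] := uniq_min_size un sub; rewrite size_map.
Qed.

(* The sum over all coroots is invariant under reflections because these
   permute the coroots; it replaces the Weyl-invariant scalar product. *)
Definition form x y : int := \sum_(c <- rd_coroots R) <<x, c>> * <<y, c>>.

Lemma formC x y : form x y = form y x.
Proof. by apply: eq_bigr => c _; rewrite mulrC. Qed.

Lemma formDl x1 x2 y : form (x1 + x2) y = form x1 y + form x2 y.
Proof. by rewrite -big_split; apply: eq_bigr => c _; rewrite pairingDl mulrDl. Qed.

Lemma formZl k x y : form (k *: x) y = k * form x y.
Proof. by rewrite mulr_sumr; apply: eq_bigr => c _; rewrite pairingZl mulrA. Qed.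

Lemma formNl x y : form (- x) y = - form x y.
Proof. by rewrite -scaleN1r formZl mulN1r. Qed.

Lemma formDr x y1 y2 : form x (y1 + y2) = form x y1 + form x y2.
Proof. by rewrite formC formDl !(formC x). Qed.

Lemma formZr k x y : form x (k *: y) = k * form x y.
Proof. by rewrite formC formZl (formC x). Qed.

Lemma formNr x y : form x (- y) = - form x y.
Proof. by rewrite formC formNl (formC x). Qed.

Definition formE := (formDl, formDr, formNl, formNr, formZl, formZr).

Lemma form_refl a x y : a \in Phi -> form (refl a x) (refl a y) = form x y.
Proof.
move=> aR; rewrite [RHS]/form -(perm_big _ (corefl_perm aR)) big_map /=.
by apply: eq_bigr => c _; rewrite !pairing_refl.
Qed.

Lemma form_ge0 x : 0 <= form x x.
Proof. by apply: sumr_ge0 => c _; rewrite -expr2 sqr_ge0. Qed.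

Lemma form_eq0 x : form x x = 0 -> {in rd_coroots R, forall c, <<x, c>> = 0}.
Proof.
move=> /eqP; rewrite psumr_eq0 => [|c _]; last by rewrite -expr2 sqr_ge0.
by move=> /allP x0 c /x0; rewrite /= mulf_eq0 orbb => /eqP.
Qed.

(** The coroot of [a] itself contributes the nonzero term 2^2. *)
Lemma form_gt0 a : a \in Phi -> 0 < form a a.
Proof.
move=> aR; rewrite lt_def form_ge0 andbT; apply/eqP => /form_eq0.
by move=> /(_ _ (coroot_mem aR)); rewrite rd_pairing2.
Qed.

(** Reflection negates [a], so invariance reads [<<x, a^v>> * form a a - form a x = form a x]. *)
Lemma pairing_form a x : a \in Phi -> <<x, a^v>> * form a a = 2 * form a x.
Proof.
move=> aR; have := form_refl a x aR.
by rewrite /refl (rd_pairing2 aR) !formE; lia.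
Qed.

(** By [pairing_form], a coroot is determined by the form, which reflections preserve. *)
Lemma coroot_refl a b : a \in Phi -> b \in Phi -> (refl a b)^v = corefl a b^v.
Proof.
move=> aR bR; have rR : refl a b \in Phi by apply: rd_reflect.
apply: pairing_injr => x; have b0 := form_gt0 bR.
have reflK : refl a (refl a x) = x.
  rewrite /refl !pairingE (rd_pairing2 aR) -addrA -opprD -scalerDl.
  by rewrite mulr_natr mulr2n addrA subrr scale0r subr0.
apply: (mulIf (lt0r_neq0 b0)); rewrite -pairing_refl pairing_form //.
by rewrite -(form_refl b b aR) pairing_form // -(form_refl b _ aR) reflK.
Qed.

Lemma root_neq0 a : a \in Phi -> a != 0.
Proof.
move=> aR; apply/eqP=> a0; have := rd_pairing2 aR.
by rewrite {1}a0 -(scale0r 0) pairingZl mul0r.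
Qed.

Lemma refl_self a : a \in Phi -> refl a a = - a.
Proof.
by move=> aR; rewrite /refl rd_pairing2 // scaler_nat mulr2n opprD addrA subrr add0r.
Qed.

Lemma rootN a : a \in Phi -> - a \in Phi.
Proof. by move=> aR; rewrite -refl_self //; apply: rd_reflect. Qed.

Lemma corootN a : a \in Phi -> (- a)^v = - a^v.
Proof.
move=> aR; rewrite -(refl_self aR) coroot_refl // /corefl rd_pairing2 //.
by rewrite scaler_nat mulr2n opprD addrA subrr add0r.
Qed.

Lemma pairing_eq0_sym a b :
  a \in Phi -> b \in Phi -> <<a, b^v>> = 0 -> <<b, a^v>> = 0.
Proof.
move=> aR bR ab0; have a0 := form_gt0 aR.
apply: (mulIf (lt0r_neq0 a0)).
by rewrite mul0r pairing_form // formC -pairing_form // ab0 mul0r.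
Qed.

(** The product is [4 * form a b ^ 2] divided by [form a a * form b b]. *)
Lemma mul_pairing_ge0 a b :
  a \in Phi -> b \in Phi -> 0 <= <<a, b^v>> * <<b, a^v>>.
Proof.
move=> aR bR; have a0 := form_gt0 aR; have b0 := form_gt0 bR.
have := pairing_form b aR; have := pairing_form a bR; rewrite (formC b a).
move: <<a, b^v>> <<b, a^v>> => k l; nia.
Qed.

(** The vector is twice the component of [a] orthogonal to [b]; its norm yields the bound 4 and the
    equality case. *)
Lemma form_mul_pairing a b : a \in Phi -> b \in Phi ->
  form (2 *: a - <<a, b^v>> *: b) (2 *: a - <<a, b^v>> *: b)
    = (4 - <<a, b^v>> * <<b, a^v>>) * form a a.
Proof.
move=> aR bR; rewrite !formE.
have := pairing_form b aR; have := pairing_form a bR; rewrite (formC b a).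
by move: <<a, b^v>> <<b, a^v>> (form a b) => k l m; nia.
Qed.

Lemma mul_pairing_le4 a b :
  a \in Phi -> b \in Phi -> <<a, b^v>> * <<b, a^v>> <= 4.
Proof.
move=> aR bR; have := form_ge0 (2 *: a - <<a, b^v>> *: b).
by rewrite form_mul_pairing // pmulr_lge0 ?form_gt0 // subr_ge0.
Qed.

(** * Even Cartan integers and root strings *)

Section SimplyConnected.
Hypothesis scR : simply_connected R.

Lemma sc_ind (Q : 'rV[int]_n -> Prop) :
    Q 0 -> (forall y z, Q y -> Q z -> Q (y + z)) ->
    (forall k y, Q y -> Q (k *: y)) -> {in Phi, forall a, Q a^v} ->
  forall y, Q y.
Proof.
move=> Q0 QD QZ QR y; have [c ->] := scR y.
by apply: big_ind => // a _; apply/QZ/QR/valP.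
Qed.

(** The difference has norm 0, hence pairs to 0 with all coroots, and these span Y. *)
Lemma mul_pairing_eq4 a b : a \in Phi -> b \in Phi ->
  <<a, b^v>> * <<b, a^v>> = 4 -> 2 *: a = <<a, b^v>> *: b.
Proof.
move=> aR bR ab4; apply/eqP; rewrite -subr_eq0; apply/eqP.
have := form_mul_pairing aR bR; rewrite ab4 subrr mul0r => /form_eq0 z0.
apply: pairing_eq0l; apply: sc_ind => [|y1 y2|k y|c cR].
- by rewrite -(scale0r 0) pairingZr mul0r.
- by rewrite pairingDr => -> ->.
- by rewrite pairingZr => ->; rewrite mulr0.
- exact/z0/coroot_mem.
Qed.

(** A nonzero product of two even integers in [0, 4] is 4, which forces [2 *: a] to be [2 *: b] or
    its negative. *)
Lemma even_orthogonal a b : a \in Phi -> b \in Phi ->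
    a != b -> a != - b -> (2 %| <<a, b^v>>)%Z -> (2 %| <<b, a^v>>)%Z ->
  <<a, b^v>> = 0.
Proof.
move=> aR bR /eqP ab /eqP aNb ev1 ev2.
have le4 := mul_pairing_le4 aR bR; have ge0 := mul_pairing_ge0 aR bR.
have eq4 := mul_pairing_eq4 aR bR; have eq0 := pairing_eq0_sym bR aR.
have sc2 : injective (fun x : 'rV[int]_n => 2 *: x) by apply: scalemx_inj.
case/dvdzP: ev1 ev2 le4 ge0 eq4 eq0 => k -> /dvdzP[l ->] le4 ge0 eq4 eq0.
have [l0|l0] := eqVneq l 0; first by apply: eq0; rewrite l0.
have [k0|k0] := eqVneq k 0; first by rewrite k0.
have [k1|k1] : k = 1 \/ k = -1 by nia.
  by case: ab; apply: sc2; rewrite eq4 k1 ?mul1r //; nia.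
by case: aNb; apply: sc2; rewrite eq4 k1 ?scalerN ?mulN1r ?scaleNr //; nia.
Qed.

(** Reflection in [c] sends [b + c] to [b - c], so [p] is at least 1. *)
Lemma orthogonal_string_length b c p : b \in Phi -> c \in Phi ->
  b + c \in Phi -> <<b, c^v>> = 0 -> is_string_length R b c p -> p = 1.
Proof.
move=> bR cR bcR bc0 [gR pmax].
have p1 : 1 <= p.
  apply: pmax; have := rd_reflect cR bcR.
  rewrite pairingDl bc0 add0r (rd_pairing2 cR) scaler_nat mulr2n scale1r.
  by rewrite opprD addrA addrK.
(* If p > 1, then <g, c^vee> = - 2 p <= - 4 exceeds the bound on Cartan integers. *)
set g := b - p *: c in gR.
have gc : <<g, c^v>> = - (2 * p) by rewrite !pairingE bc0 (rd_pairing2 cR); ring.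
have le4 := mul_pairing_le4 gR cR; have ge0 := mul_pairing_ge0 gR cR.
have eq4 := mul_pairing_eq4 gR cR; have eq0 := pairing_eq0_sym cR gR.
rewrite gc in le4 ge0 eq4 eq0.
have [cg0|cg0] := eqVneq <<c, g^v>> 0; first by move: (eq0 cg0); lia.
apply/eqP; apply: contraT => pn1.
(* The bound 4 leaves only [p = 2], with Cartan integers -4 and -1; the equality case then gives
   [2 *: g = -4 *: c], so [b = 0]. *)
have p2 : p = 2 by nia.
have b2 : 2 *: b = 2 *: 0.
  have /eqP : 2 *: g = - (2 * p) *: c by apply: eq4; nia.
  rewrite /g p2 scalerBr scaleNr scalerA subr_eq addNr => /eqP ->.
  by rewrite scaler0.
by move: (root_neq0 bR); rewrite (scalemx_inj _ b2) ?eqxx.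
Qed.

End SimplyConnected.

Lemma even_structure_constant (N : 'rV[int]_n -> 'rV[int]_n -> int) b c :
    simply_connected R -> is_structure_constants R N ->
    b \in Phi -> c \in Phi -> b + c \in Phi ->
    {in Phi, forall d, (2 %| <<(b + c)%R, d^v>>)%Z} ->
  (2 %| N b c)%Z.
Proof.
move=> scR [NE _ _] bR cR bcR ev.
have bnc : b != c.
  by apply: contraTneq bcR => ->; apply: rd_reduced.
have bnNc : b != - c.
  by apply: contraTneq (root_neq0 bcR) => ->; rewrite addNr eqxx.
(* Pairing [b + c] with the coroot of [c] adds 2 to [<<b, c^v>>], which keeps its parity. *)
have ev1 : (2 %| <<b, c^v>>)%Z.
  have := ev c cR; rewrite pairingDl (rd_pairing2 cR) => h.
  by rewrite -(addrK 2 <<b, c^v>>) rpredB.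
have ev2 : (2 %| <<c, b^v>>)%Z.
  have := ev b bR; rewrite pairingDl (rd_pairing2 bR) => h.
  by rewrite -(addKr 2 <<c, b^v>>) rpredD.
have bc0 := even_orthogonal scR bR cR bnc bnNc ev1 ev2.
have [p sp] := NE b c bR cR bnc bnNc bcR.
by rewrite (orthogonal_string_length scR bR cR bcR bc0 sp) => -[] ->.
Qed.

(** * Simple roots generate all roots by reflections *)

Section Base.
Variables (m : nat) (D : 'I_m -> 'rV[int]_n).
Hypothesis baseD : is_base R D.

Lemma base_coef_uniq (c c' : 'I_m -> int) :
  \sum_i c i *: D i = \sum_i c' i *: D i -> c =1 c'.
Proof.
case: baseD => _ free _ /eqP; rewrite -subr_eq0 -sumrB => /eqP eqc i.
apply/eqP; rewrite -subr_eq0; apply/eqP; apply: (free (fun i => c i - c' i)).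
by rewrite -[RHS]eqc; apply: eq_bigr => j _; rewrite scalerBl.
Qed.

Lemma form_suml (c : 'I_m -> int) y :
  form (\sum_i c i *: D i) y = \sum_i c i * form (D i) y.
Proof.
elim/big_rec2: _ => [|i k x _ <-]; last by rewrite !formE.
by rewrite -(scale0r 0) formZl mul0r.
Qed.

(** Here [k] divides 2, and reducedness excludes [k = 2]. *)
Lemma root_multiple a b (k : int) :
  a \in Phi -> b \in Phi -> 0 <= k -> b = k *: a -> b = a.
Proof.
move=> aR bR k0 bE; have := rd_pairing2 bR; rewrite {1}bE pairingZl => k2.
have [k1|k1] : k = 1 \/ k = 2.
    have l1 : 1 <= <<a, b^v>> by nia.
    by nia.
  by rewrite bE k1 scale1r.
by move: (rd_reduced aR); rewrite -mulr2n -scaler_nat -k1 -bE bR.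
Qed.

(** Otherwise every term of [form b b], expanded over simple roots, would be nonpositive. *)
Lemma descent (c : 'I_m -> int) b : b \in Phi -> (forall i, 0 <= c i) ->
  b = \sum_i c i *: D i -> exists i, 0 < <<b, (D i)^v>>.
Proof.
case: baseD => DR _ _ bR c0 bE; apply/existsP; apply: contraT.
rewrite negb_exists => /forallP le0.
have := form_gt0 bR; rewrite {1}bE form_suml ltNge => /negP[].
apply: sumr_le0 => i _; apply: mulr_ge0_le0 => //.
have := le0 i; rewrite -leNgt => {}le0.
by have := form_gt0 (DR i); have := pairing_form b (DR i); nia.
Qed.

(* Induction on the height of positive roots: some simple reflection lowers it,
   unless the root is itself simple. *)
Lemma base_ind (Q : 'rV[int]_n -> Prop) :
    (forall i, Q (D i)) -> {in Phi, forall b, Q (- b) -> Q b} ->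
    {in Phi, forall b i, Q (refl (D i) b) -> Q b} ->
  {in Phi, forall b, Q b}.
Proof.
move=> QD QN Qrefl; case: (baseD) => DR _ sgn.
have ltS (k : int) : k < (absz k).+1 by lia.
suff pos (k : nat) b (c : 'I_m -> int) : b \in Phi -> (forall i, 0 <= c i) ->
    b = \sum_i c i *: D i -> \sum_i c i < k%:Z -> Q b.
  move=> b bR; have [c [bE [c0|c0]]] := sgn b bR.
    exact: pos c0 bE (ltS _).
  apply: QN => //; apply: (pos (absz (\sum_i - c i)).+1 _ (fun i => - c i)).
  - exact: rootN.
  - by move=> i; rewrite oppr_ge0.
  - by rewrite bE -sumrN; apply: eq_bigr => i _; rewrite scaleNr.
  exact: ltS.
elim: k b c => [|k IHk] b c bR c0 bE ltk.
  by have : 0 <= \sum_i c i by [exact: sumr_ge0]; lia.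
have [i bi] := descent bR c0 bE; set l := <<b, (D i)^v>> in bi.
have rR : refl (D i) b \in Phi by exact: rd_reflect.
have lt_pred (s : int) : s < k.+1 -> s - l < k by lia.
(* Reflection in [D i] lowers only coefficient [i], by [l > 0]. *)
pose d j := c j - l * (j == i)%:R.
have dE : refl (D i) b = \sum_j d j *: D j.
  rewrite /refl -/l {1}bE; under [RHS]eq_bigr do rewrite scalerBl.
  rewrite sumrB; congr (_ - _); rewrite (bigD1 i) //= eqxx mulr1 big1 ?addr0 //.
  by move=> j /negPf->; rewrite mulr0 scale0r.
have [c' [rE sg]] := sgn _ rR.
have c'E := base_coef_uniq (etrans (esym dE) rE).
have [{}sg|{}sg] := sg.
  apply: (Qrefl b bR i); apply: (IHk _ d rR) => // [j|]; first by rewrite c'E.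
  rewrite sumrB [X in _ - X](bigD1 i) //= eqxx mulr1.
  rewrite [X in l + X]big1 => [|j /negPf->]; last by rewrite mulr0.
  by rewrite addr0; apply: lt_pred.
(* If the reflected root is negative, the unchanged coefficients vanish, so [b] is a multiple of
   [D i]. *)
rewrite (root_multiple (DR i) bR (c0 i)) //.
rewrite {1}bE (bigD1 i) //= big1 ?addr0 // => j /negPf ji.
have := sg j; rewrite -c'E /d ji mulr0 subr0 => cj.
have /eqP -> : c j == 0 by rewrite eq_le cj c0.
by rewrite scale0r.
Qed.

(** Reflecting [b] in [D i] changes [<<a, b^v>>] by a multiple of [<<a, (D i)^v>>]. *)
Lemma even_pairing_coroot a : (forall i, (2 %| <<a, (D i)^v>>)%Z) ->
  {in Phi, forall b, (2 %| <<a, b^v>>)%Z}.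
Proof.
move=> ev; apply: base_ind => // b bR.
  by rewrite corootN // pairingNr rpredN.
case: baseD => DR _ _ i; rewrite coroot_refl // /corefl !pairingE => h.
rewrite -(subrK (<<D i, b^v>> * <<a, (D i)^v>>) <<a, b^v>>).
by rewrite rpredD // dvdz_mull.
Qed.

End Base.

End RootDatum.

(** * The hyperplane of the Chevalley algebra where the coefficient of X_a vanishes *)

Section Bracket.
Variables (n : nat) (R : root_datum n) (F : fieldType).
Variable N : 'rV[int]_n -> 'rV[int]_n -> int.
Local Notation L := (chevalley R F).
Local Notation br := (@bracket n R F N).

Lemma root_eval_linear (a : rd_roots R) : linear (@root_eval n R F a : _ -> F^o).
Proof.
by move=> k y z; rewrite /root_eval linearP mulmxDr -scalemxAr !mxE.
Qed.

Lemma bracket_linear_r (x : L) : linear (br x).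
Proof.
move=> k u v; rewrite /bracket scalerDr addrACA !scaler_sumr -!big_split /=.
apply: eq_bigr => a _; congr (_ + _).
  rewrite (root_eval_linear a k u.1 v.1) !ffunE scalerA -scalerDl; congr (_ *: _).
  by rewrite /GRing.scale /=; ring.
rewrite scaler_sumr -big_split; apply: eq_bigr => b _ /=.
rewrite !ffunE scalerA -scalerDl; congr (_ *: _).
by rewrite /GRing.scale /=; ring.
Qed.

Lemma bracket_linear_l (y : L) : linear (br^~ y).
Proof.
move=> k u v; rewrite /bracket scalerDr addrACA !scaler_sumr -!big_split /=.
apply: eq_bigr => a _; congr (_ + _).
  rewrite (root_eval_linear a k u.1 v.1) !ffunE scalerA -scalerDl; congr (_ *: _).
  by rewrite /GRing.scale /=; ring.
rewrite scaler_sumr -big_split; apply: eq_bigr => b _ /=.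
rewrite !ffunE scalerA -scalerDl; congr (_ *: _).
by rewrite /GRing.scale /=; ring.
Qed.

Definition root_coef (a : rd_roots R) (u : L) : F^o := u.2 a.

Lemma root_coef_linear a : linear (root_coef a).
Proof. by move=> k u v; rewrite /root_coef /= !ffunE. Qed.

HB.instance Definition _ a := GRing.isLinear.Build F L F^o _ _ (root_coef_linear a).

Lemma root_coef_root_elt a b : root_coef a (root_elt F b) = (a == b)%:R.
Proof. by rewrite /root_coef ffunE. Qed.

Section EvenRoot.
Hypothesis charF : 2%N \in [pchar F].
Hypothesis scR : simply_connected R.
Hypothesis structN : is_structure_constants R N.
Variable a : rd_roots R.
Hypothesis even_a :
  {in rd_roots R, forall d, (2 %| rd_pairing R (val a) (rd_coroot R d))%Z}.

Lemma intr_even (k : int) : (2 %| k)%Z -> k%:~R = 0 :> F.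
Proof. by case/dvdzP => l ->; rewrite intrM [2%:~R](pcharf0 charF) mulr0. Qed.

Lemma root_eval_even y : root_eval a y = 0 :> F.
Proof.
suff a0 : map_mx intr (val a *m rd_gram R) = 0 :> 'rV[F]_n.
  by rewrite /root_eval a0 mul0mx mxE.
apply/rowP=> j; rewrite mxE [RHS]mxE; apply: intr_even.
have ev y' : (2 %| rd_pairing R (val a) y')%Z.
  move: y'; apply: (sc_ind scR) => [|y1 y2|k y1|d /even_a//].
  - by rewrite -(scale0r 0) pairingZr mul0r.
  - by rewrite pairingDr; apply: rpredD.
  - by rewrite pairingZr; apply: dvdz_mull.
by have := ev (delta_mx 0 j); rewrite /rd_pairing /gram_pairing trmx_delta -colE mxE.
Qed.

(** X_a can only occur when [b + c = a], and then [N b c] is even. *)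
Lemma root_coef_root_bracket b c : root_coef a (root_bracket F N b c) = 0.
Proof.
rewrite /root_bracket; case: eqP => _; first by rewrite /root_coef ffunE.
case: insubP => [d dR dE|_]; last exact: raddf0.
rewrite linearZZ /= root_coef_root_elt /=; case: eqP => [ad|_]; last exact: scaler0.
rewrite intr_even ?scale0r //.
apply: even_structure_constant => //; try exact: valP.
by rewrite -dE -ad.
Qed.

Lemma root_coef_bracket u v : root_coef a (br u v) = 0.
Proof.
rewrite /bracket linearD !linear_sum [X in _ + X]big1 ?addr0 => [|b _].
  rewrite big1 // => b _; rewrite linearZZ /= root_coef_root_elt.
  case: eqP => [<-|_]; last exact: scaler0.
  by rewrite !root_eval_even !mulr0 subr0 scale0r.
rewrite linear_sum big1 // => c _.
by rewrite linearZZ /= root_coef_root_bracket; apply: scaler0.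
Qed.

(** Modulo brackets [pm] is additive, and it squares scalars, so torus and root elements suffice. *)
Lemma root_coef_pmap (pm : L -> L) u :
  is_chevalley_pmap N 2 pm -> root_coef a (pm u) = 0.
Proof.
case=> pmP pm_root pm_torus.
have cD x y : root_coef a (pm x) = 0 -> root_coef a (pm y) = 0 ->
    root_coef a (pm (x + y)) = 0.
  by rewrite (pmD pmP) 2!raddfD /= => -> ->; rewrite root_coef_bracket !addr0.
have cZ k x : root_coef a (pm x) = 0 -> root_coef a (pm (k *: x)) = 0.
  by rewrite (pmZ pmP) linearZZ /= => ->; apply: scaler0.
have c0 : root_coef a (pm 0) = 0 by rewrite (pm0 pmP) raddf0.
have csum (I : finType) (k : I -> F) (f : I -> L) :
    (forall i, root_coef a (pm (f i)) = 0) ->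
  root_coef a (pm (\sum_i k i *: f i)) = 0.
  by move=> f0; apply: (big_ind (fun x => root_coef a (pm x) = 0)) => // i _; exact: cZ.
have -> : u = \sum_j u.1 0 j *: torus_elt R F (delta_mx 0 j)
              + \sum_b u.2 b *: root_elt F b.
  rewrite [LHS]surjective_pairing; apply/eqP.
  have sum1 (I : finType) (f : I -> L) : (\sum_i f i).1 = \sum_i (f i).1.
    exact: (raddf_sum (fst : L -> _)).
  have sum2 (I : finType) (f : I -> L) : (\sum_i f i).2 = \sum_i (f i).2.
    exact: (raddf_sum (snd : L -> _)).
  rewrite -pair_eqE /= sum1 sum2 sum1 sum2 /=.
  rewrite [X in _ == _ + X]big1 ?addr0 => [|b _]; last exact: scaler0.
  rewrite [X in _ && (_ == X + _)]big1 ?add0r => [|b _]; last exact: scaler0.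
  apply/andP; split; apply/eqP.
    rewrite [LHS]row_sum_delta; apply: eq_bigr => j _.
    by rewrite map_delta_mx.
  apply/ffunP=> c; rewrite sum_ffunE (bigD1 c) //= !ffunE eqxx.
  rewrite big1 ?addr0 => [|b bc]; first by rewrite /GRing.scale /= mulr1.
  by rewrite !ffunE eq_sym (negPf bc); exact: scaler0.
apply: cD; [apply: csum => j|apply: csum => b].
  by rewrite pm_torus /root_coef ffunE.
by rewrite pm_root raddf0.
Qed.

Lemma no_regular_semisimple_chevalley (pm : L -> L) :
  is_chevalley_pmap N 2 pm -> forall x, ~ regular_semisimple br pm x.
Proof.
move=> pmP; have [pmP' _ _] := pmP.
have cE u : (u \in lker (linfun (root_coef a))) = (root_coef a u == 0).
  by rewrite memv_ker lfunE.
apply: (no_regular_semisimple charF bracket_linear_r bracket_linear_l pmP'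
          (M := lker (linfun (root_coef a)))).
- by move=> x y; rewrite cE root_coef_bracket.
- by move=> x; rewrite cE root_coef_pmap.
apply: contraTneq (memvf (root_elt F a)) => <-.
by rewrite cE root_coef_root_elt eqxx oner_eq0.
Qed.

End EvenRoot.

Lemma no_regular_semisimple_SC m (C : 'M[int]_m) i :
    2%N \in [pchar F] -> is_type_SC R C -> (forall j, (2 %| C i j)%Z) ->
    is_structure_constants R N ->
  forall pm : L -> L, is_chevalley_pmap N 2 pm ->
  forall x, ~ regular_semisimple br pm x.
Proof.
move=> charF [scR [D [baseD DC]]] evC structN pm pmP.
have DR : D i \in rd_roots R by case: baseD.
apply: (@no_regular_semisimple_chevalley charF scR structN [` DR]%fset) => //=.
by apply: (even_pairing_coroot baseD) => j; rewrite DC.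
Qed.

End Bracket.

Theorem proposition7 (F : fieldType) (charF : 2%N \in [pchar F])
    (n : nat) (R : root_datum n)
    (typeR : [\/ is_type_SC R (cartanA 1), is_type_SC R (cartanB 2)
               | (3 <= n)%N /\ is_type_SC R (cartanC n)])
    (N : 'rV[int]_n -> 'rV[int]_n -> int)
    (structN : is_structure_constants R N)
    (pm : chevalley R F -> chevalley R F)
    (pmapF : is_chevalley_pmap N 2 pm) :
  ~ exists x : chevalley R F, regular_semisimple (bracket N (K := F)) pm x.
Proof.
case=> x; case: typeR => [tR|tR|[n3 tR]].
- apply: (no_regular_semisimple_SC (i := ord0) charF tR _ structN pmapF) => j.
  by rewrite mxE (ord1 j).
(* The first simple root of B_2 is long, with row (2, -2). *)
- apply: (no_regular_semisimple_SC (i := ord0) charF tR _ structN pmapF) => j.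
  by rewrite !mxE; case: j => -[|[]].
(* The last row in type C has only the nonzero entries -2 and 2. *)
have ltn : (n.-1 < n)%N by lia.
apply: (no_regular_semisimple_SC (i := Ordinal ltn) charF tR _ structN pmapF) => j.
rewrite !mxE -!val_eqE /= prednK ?eqxx ?andbT; last by lia.
case: ifP => // j1; case: ifP => // _; rewrite ?j1 orbF.
by rewrite (gtn_eqF (ltn_ord j)).
Qed.
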